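(* Let $A\in\mathbb R^{n\times n}$ and $B\in\mathbb R^{n\times m}$, and consider the linear system $\hat x^{+}=A(\hat x+Bu)$ with $\hat x\in\mathbb R^n$, $u\in\mathbb R^m$, for which $[x]_0:=\{x+Bu:u\in\mathbb R^m\}$ for $x\in\mathbb R^n$. Then for all $x,\hat x\in\mathbb R^n$, $\hat x\in[x]_0$ implies $[\hat x]_0=[x]_0$.
   Context: For a general system $\hat x^+=f(\mu(\hat x,u))$ with state set $\mathcal X$ and input set $\mathcal U$, one sets $[x]_0:=\mu(x,\mathcal U)=\{\mu(x,u):u\in\mathcal U\}$; the linear system corresponds to $f(x)=Ax$, $\mu(x,u)=x+Bu$, $\mathcal X=\mathbb R^n$, $\mathcal U=\mathbb R^m$. *)

(* Defs.v *)
From mathcomp Require Import all_boot all_order all_algebra.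
From mathcomp Require Import boolp classical_sets reals.

Set Implicit Arguments.
Unset Strict Implicit.
Unset Printing Implicit Defensive.

Import GRing.Theory.
Local Open Scope classical_set_scope.
Local Open Scope ring_scope.

(* The system x^+ = f (mu (x, u)) with state set X and input set U. *)
Record system (X U : Type) := System {
  sys_f : X -> X;
  sys_mu : X -> U -> X }.

Definition sys_next (X U : Type) (S : system X U) (x : X) (u : U) : X :=
  sys_f S (sys_mu S x u).

(* The set [x]_0 := mu (x, U). *)
Definition class0 (X U : Type) (S : system X U) (x : X) : set X :=
  [set sys_mu S x u | u in [set: U]].

Definition linear_system (R : realType) (n m : nat)
    (A : 'M[R]_n) (B : 'M[R]_(n, m)) : system 'cV[R]_n 'cV[R]_m :=
  System (fun x => A *m x) (fun x u => x + B *m u).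

Lemma linear_system_nextE (R : realType) (n m : nat)
    (A : 'M[R]_n) (B : 'M[R]_(n, m)) (x : 'cV[R]_n) (u : 'cV[R]_m) :
  sys_next (linear_system A B) x u = A *m (x + B *m u).
Proof. by []. Qed.

Lemma linear_system_class0E (R : realType) (n m : nat)
    (A : 'M[R]_n) (B : 'M[R]_(n, m)) (x : 'cV[R]_n) :
  class0 (linear_system A B) x = [set x + B *m u | u in [set: 'cV[R]_m]].
Proof. by []. Qed.

(* Main.v *)
Require Import Defs.
From mathcomp Require Import all_boot all_order all_algebra.
From mathcomp Require Import boolp classical_sets reals.

Import GRing.Theory.

(** The set of all [x + B *m u] is the coset of [x] modulo the column space of [B], and a coset is
    the same whichever of its points represents it. Only closure of the inputs under sum and
    difference and additivity of [B] are used. *)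

Theorem theorem2 (R : realType) (n m : nat)
    (A : 'M[R]_n) (B : 'M[R]_(n, m)) (x xhat : 'cV[R]_n) :
  xhat \in class0 (linear_system A B) x ->
  class0 (linear_system A B) xhat = class0 (linear_system A B) x.
Proof.
rewrite inE linear_system_class0E => -[u _ <-].
rewrite linear_system_class0E; apply/seteqP; split=> _ [v _ <-].
- by exists (u + v)%R => //; rewrite mulmxDr addrA.
(* With [xhat] equal to [x + B *m u], the input [v - u] first cancels the shift by [u], then applies
   [v]. *)
- by exists (v - u)%R => //; rewrite -addrA -mulmxDr [(u + _)%R]addrC subrK.
Qed.
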